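(* Let $(\mathcal{A},\varphi)$ be an algebraic noncommutative probability space, let $a\in\mathcal{A}$ be such that $\varphi(a)=1$, and consider the reciprocal $S$-transform $1/S_a(z)=\sum_{n=0}^{\infty}t_nz^n$. Then for every $n\ge 1$ one has $$\varphi(a^n)=\sum_{\alpha\in NC(n)}\Bigl(\prod_{U\in\alpha,\ U\text{ outer}}t_{|U|-1}\Bigr)\cdot\Bigl(\prod_{V\in\alpha,\ V\text{ inner}}\bigl(t_{|V|-1}+t_{|V|}\bigr)\Bigr).$$
   Context: An algebraic noncommutative probability space $(\mathcal{A},\varphi)$ consists of a unital algebra $\mathcal{A}$ over $\mathbb{C}$ and a linear functional $\varphi:\mathcal{A}\to\mathbb{C}$ with $\varphi(1_{\mathcal{A}})=1$. For $a\in\mathcal{A}$ with $\varphi(a)=1$, the moment series is the formal power series $M_a(z):=\sum_{n=1}^{\infty}\varphi(a^n)z^n$, and the $S$-transform of $a$ is the series $S_a(z):=\frac{1+z}{z}M_a^{\langle -1\rangle}(z)\in\mathbb{C}[[z]]$, where $M_a^{\langle -1\rangle}$ is the inverse of $M_a$ under composition. $S_a$ has constant term $1$, and $1/S_a(z)=\sum_{n=0}^\infty t_nz^n$ denotes its inverse under multiplication (so $t_0=1$). $NC(n)$ denotes the set of non-crossing partitions of $\{1,\ldots,n\}$, and $V\in\alpha$ means that $V$ is a block of $\alpha$. A block $V$ of $\alpha\in NC(n)$ is inner (respectively outer) if there exists (respectively does not exist) another block $V'$ of $\alpha$ such that $\min(V')<\min(V)$ and $\max(V')>\max(V)$. *)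

(* Defs.v *)
From mathcomp Require Import all_boot all_order all_algebra.
From mathcomp Require Import reals complex.

Set Implicit Arguments.
Unset Strict Implicit.
Unset Printing Implicit Defensive.

Import GRing.Theory.
Local Open Scope ring_scope.

Section FormalPowerSeries.
Variable K : fieldType.

(* f : fps stands for the series \sum_n f n z^n. *)
Definition fps := nat -> K.

Implicit Types f g h : fps.

Definition fps_one : fps := fun n => (n == 0%N)%:R.
Definition fps_X : fps := fun n => (n == 1%N)%:R.
Definition fps_add f g : fps := fun n => f n + g n.
Definition fps_mul f g : fps := fun n => \sum_(i < n.+1) f i * g (n - i)%N.
Definition fps_exp f k : fps := iter k (fps_mul f) fps_one.

(* Meaningful when g 0 = 0: then g^k has no term of degree < k, so that the
   powers k > n do not contribute to the coefficient of z^n. *)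
Definition fps_comp f g : fps :=
  fun n => \sum_(k < n.+1) f k * fps_exp g k n.

(* Meaningful when f 0 = 0. *)
Definition fps_divX f : fps := fun n => f n.+1.

(* The series g such that g n = F n g', where g' is g truncated to the terms of
   degree < n. *)
Fixpoint fps_rec_seq (F : nat -> fps -> K) n : seq K :=
  if n is m.+1 then
    let s := fps_rec_seq F m in rcons s (F m (nth 0 s))
  else [::].
Definition fps_rec F : fps := fun n => (fps_rec_seq F n.+1)`_n.

(* The coefficient of z^n in f * g is f 0 * g n plus the coefficient of z^n in
   f * g', with g' as above; equate it with that of 1 and solve for g n. *)
Definition fps_inv f : fps :=
  fps_rec (fun n g' => (fps_one n - fps_mul f g' n) / f 0%N).

(* If f 0 = g 0 = 0, the coefficient of z^n in f(g(z)) is f 1 * g n plus the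
   coefficient of z^n in f(g'(z)); equate it with that of z and solve for
   g n. *)
Definition fps_compinv f : fps :=
  fps_rec (fun n g' => (fps_X n - fps_comp f g' n) / f 1%N).

Lemma size_fps_rec_seq F n : size (fps_rec_seq F n) = n.
Proof. by elim: n => //= n IHn; rewrite size_rcons IHn. Qed.

Lemma fps_rec_seqE F n : fps_rec_seq F n = mkseq (fps_rec F) n.
Proof.
elim: n => // n IHn; rewrite /mkseq -addn1 iotaD map_cat -/(mkseq _ _) -IHn.
rewrite addn1 [LHS]/= -cats1; congr (_ ++ [:: _]).
by rewrite /fps_rec /= nth_rcons size_fps_rec_seq add0n ltnn eqxx.
Qed.

Lemma fps_recE F n : fps_rec F n = F n (nth 0 (mkseq (fps_rec F) n)).
Proof.
by rewrite {1}/fps_rec /= nth_rcons size_fps_rec_seq ltnn eqxx fps_rec_seqE.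
Qed.

Lemma nth_mkseq0 f n i : (mkseq f n)`_i = if (i < n)%N then f i else 0.
Proof.
by case: ltnP => ?; [rewrite nth_mkseq | rewrite nth_default ?size_mkseq].
Qed.

Lemma fps_mulV f : f 0%N != 0 -> fps_mul f (fps_inv f) =1 fps_one.
Proof.
move=> f0 n; rewrite /fps_mul big_ord_recl subn0 {1}/fps_inv fps_recE.
rewrite mulrCA divff // mulr1 -/(fps_inv f) -[RHS]subr0 -addrA; congr (_ + _).
apply/eqP; rewrite oppr0 addrC subr_eq0; apply/eqP.
rewrite /fps_mul [RHS]big_ord_recl subn0 nth_mkseq0 ltnn mulr0 add0r.
by apply: eq_bigr => i _; rewrite nth_mkseq0 ifT // ltn_subrL (leq_ltn_trans _ (ltn_ord i)).
Qed.

Lemma fps_exp_lt g k n : g 0%N = 0 -> (n < k)%N -> fps_exp g k n = 0.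
Proof.
move=> g0; elim: k n => // k IHk n ltnk.
rewrite /fps_exp iterS -/(fps_exp g k) /fps_mul big_ord_recl g0 mul0r add0r.
apply: big1 => i _; rewrite IHk ?mulr0 //=.
have := ltn_ord i; rewrite /bump /= => ltin.
by apply: leq_trans (_ : n <= k)%N; rewrite // ltn_subrL; apply: leq_ltn_trans ltin.
Qed.

Let trunc n f : {poly K} := \poly_(i < n) f i.
Let agree n f (p : {poly K}) := forall i, (i < n)%N -> f i = p`_i.

Let agree_trunc n f : agree n f (trunc n f).
Proof. by move=> i ltin; rewrite coef_poly ltin. Qed.

Let agree_mul n f g p q :
  agree n f p -> agree n g q -> agree n (fps_mul f g) (p * q).
Proof.
move=> fp gq i ltin; rewrite coefM; apply: eq_bigr => j _.
rewrite fp ?gq //; first exact: leq_ltn_trans (leq_subr _ _) ltin.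
by apply: leq_trans (ltn_ord j) _.
Qed.

Let agree_exp n g q k : agree n g q -> agree n (fps_exp g k) (q ^+ k).
Proof.
move=> gq; elim: k => [|k IHk].
  by move=> i _; rewrite expr0 coef1.
by rewrite exprS; apply: agree_mul.
Qed.

Let agree_comp n f g p q : g 0%N = 0 ->
  agree n f p -> agree n g q -> agree n (fps_comp f g) (p \Po q).
Proof.
move=> g0 fp gq i ltin; rewrite coef_comp_poly /fps_comp.
pose G k := p`_k * (q ^+ k)`_i.
have widen m c : (c <= m)%N ->
    \sum_(k < c) G k = \sum_(k < m) if (k < c)%N then G k else 0.
  by move=> lecm; rewrite (big_ord_widen _ G lecm) big_mkcond.
transitivity (\sum_(k < i.+1) G k).
  apply: eq_bigr => k _; rewrite (agree_exp k gq) ?fp //.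
  exact: leq_trans (ltn_ord k) _.
rewrite -/(\sum_(k < size p) G k) (widen _ _ (leq_maxr (size p) i.+1)).
rewrite [RHS](widen _ _ (leq_maxl (size p) i.+1)).
apply: eq_bigr => k _; case: ltnP => leik; case: ltnP => // lepk.
  by rewrite /G nth_default ?mul0r.
by rewrite /G -(agree_exp k gq ltin) fps_exp_lt ?mulr0.
Qed.

Lemma fps_comp0 f g : fps_comp f g 0%N = f 0%N.
Proof. by rewrite /fps_comp big_ord1 /= /fps_one mulr1. Qed.

Lemma fps_compA f g h : g 0%N = 0 -> h 0%N = 0 ->
  fps_comp f (fps_comp g h) =1 fps_comp (fps_comp f g) h.
Proof.
move=> g0 h0 n; have T := @agree_trunc n.+1.
rewrite (agree_comp _ (T f) (agree_comp h0 (T g) (T h))) ?fps_comp0 //.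
by rewrite (agree_comp h0 (agree_comp g0 (T f) (T g)) (T h)) // comp_polyA.
Qed.

Lemma eq_fps_comp f f' g g' : g 0%N = 0 -> f =1 f' -> g =1 g' ->
  fps_comp f g =1 fps_comp f' g'.
Proof.
move=> g0 ff gg n; have T := @agree_trunc n.+1.
rewrite (agree_comp g0 (T f) (T g)) // (@agree_comp n.+1 _ _ (trunc n.+1 f) (trunc n.+1 g)) -?gg //.
  by move=> i ltin; rewrite -ff; apply: T.
by move=> i ltin; rewrite -gg; apply: T.
Qed.

Lemma fps_compXr f : fps_comp f fps_X =1 f.
Proof.
move=> n; have T := @agree_trunc n.+1.
by rewrite (@agree_comp n.+1 _ _ _ 'X _ (T f)) ?comp_polyXr -?T // => i _; rewrite coefX.
Qed.

Lemma fps_compXl f : f 0%N = 0 -> fps_comp fps_X f =1 f.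
Proof.
move=> f0 n; have T := @agree_trunc n.+1.
rewrite (@agree_comp n.+1 _ _ 'X _ f0 _ (T f)) ?comp_polyX -?T // => i _.
by rewrite coefX.
Qed.

Let fps_exp_trunc g k n : g 0%N = 0 ->
  fps_exp (nth 0 (mkseq g n.+1)) k.+2 n.+1 = fps_exp g k.+2 n.+1.
Proof.
move=> g0; rewrite ![fps_exp _ k.+2]iterS -!/(fps_exp _ k.+1) /fps_mul.
rewrite [LHS]big_ord_recl [RHS]big_ord_recl nth_mkseq0 g0 !mul0r; congr (_ + _).
apply: eq_bigr => i _; rewrite nth_mkseq0.
rewrite [lift _ _ : nat]lift0; case: ltnP => [ltin|leni]; last first.
  have -> : (n.+1 - i.+1 = 0)%N by apply/eqP; rewrite subn_eq0.
  by rewrite (@fps_exp_lt g) // mul0r mulr0.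
have A : agree n.+1 g (trunc n.+1 g) by apply: agree_trunc.
have B : agree n.+1 (nth 0 (mkseq g n.+1)) (trunc n.+1 g).
  by move=> j ltj; rewrite nth_mkseq0 ltj A.
by rewrite (agree_exp _ A) ?(agree_exp _ B) // subSS ltnS leq_subr.
Qed.

Lemma fps_compinv0 f : f 0%N = 0 -> fps_compinv f 0%N = 0.
Proof.
by move=> f0; rewrite /fps_compinv fps_recE fps_comp0 f0 subr0 mul0r.
Qed.

Lemma fps_compinvr f : f 0%N = 0 -> f 1%N != 0 ->
  fps_comp f (fps_compinv f) =1 fps_X.
Proof.
move=> f0 f1 [|n]; first by rewrite fps_comp0 f0.
set g := fps_compinv f; have g0 : g 0%N = 0 by apply: fps_compinv0.
have exp1 h : h 0%N = 0 -> fps_exp h 1%N n.+1 = h n.+1.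
  move=> h0; rewrite /fps_exp /= /fps_mul big_ord_recr /= subnn mulr1.
  rewrite big1 ?add0r // => i _.
  by rewrite /fps_one subn_eq0 leqNgt ltn_ord mulr0.
have := erefl (g n.+1); rewrite {2}/g /fps_compinv fps_recE -/g.
move/(congr1 ( *%R (f 1%N))); rewrite mulrCA divff // mulr1 => /esym/eqP.
rewrite subr_eq => /eqP->; rewrite /fps_comp.
rewrite !big_ord_recl f0 !mul0r !add0r exp1 //; congr (_ + _).
rewrite exp1 ?nth_mkseq0 // ltnn mulr0 add0r; apply: eq_bigr => i _.
by rewrite !lift0 fps_exp_trunc.
Qed.

Lemma fps_compinvl f : f 0%N = 0 -> f 1%N != 0 ->
  fps_comp (fps_compinv f) f =1 fps_X.
Proof.
move=> f0 f1; set g := fps_compinv f.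
have g0 : g 0%N = 0 by apply: fps_compinv0.
have fg : fps_comp f g =1 fps_X by apply: fps_compinvr.
have g1 : g 1%N != 0.
  apply/eqP => g1; have := fg 1%N; rewrite /fps_comp big_ord_recl big_ord1.
  rewrite f0 mul0r add0r /= /fps_mul big_ord_recl big_ord1 /= g0 g1 !mul0r.
  by rewrite add0r mulr0 => /esym/eqP; rewrite oner_eq0.
set h := fps_compinv g; have h0 : h 0%N = 0 by apply: fps_compinv0.
have gh : fps_comp g h =1 fps_X by apply: fps_compinvr.
have fh : f =1 h.
  move=> n; rewrite -fps_compXr -(@eq_fps_comp f f _ _ _ _ gh) ?fps_comp0 //.
  rewrite fps_compA // (@eq_fps_comp _ fps_X h h h0) //.
  exact: fps_compXl.
by move=> n; rewrite (@eq_fps_comp g g f h).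
Qed.

End FormalPowerSeries.

Section STransform.
Variables (K : fieldType) (A : algType K) (phi : {scalar A}).

Definition moment_series (a : A) : fps K :=
  fun n => if n == 0%N then 0 else phi (a ^+ n).

Definition S_transform (a : A) : fps K :=
  fps_divX (fps_mul (fps_add (@fps_one K) (@fps_X K))
                    (fps_compinv (moment_series a))).

Definition recip_S_transform (a : A) : fps K := fps_inv (S_transform a).

Lemma S_transform0 a : phi a = 1 -> S_transform a 0%N = 1.
Proof.
move=> phia; rewrite /S_transform /fps_divX /fps_mul big_ord_recl big_ord1.
rewrite /= subn0 subnn fps_compinv0 // mulr0 addr0 /fps_add /fps_one /fps_X.
have := @fps_compinvr _ (moment_series a) erefl.
rewrite {1}/moment_series expr1 phia oner_eq0 => /(_ isT 1%N).
rewrite /fps_comp big_ord_recl big_ord1 mul0r add0r {1}/moment_series /=.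
rewrite phia mul1r /fps_mul big_ord_recl big_ord1 /= fps_compinv0 // mul0r.
by rewrite add0r subnn /fps_one /= mulr1 addr0 mul1r.
Qed.

End STransform.

Section NonCrossingPartitions.
Variable n : nat.
Implicit Types (alpha : {set {set 'I_n}}) (V W : {set 'I_n}).

(* {1, ..., n} is represented by the ordered set 'I_n = {0, ..., n - 1}. *)
Definition noncrossing alpha :=
  [forall V in alpha, forall W in alpha, (V != W) ==>
    ~~ [exists i in V, exists j in W, exists k in V, exists l in W,
          [&& i < j, j < k & k < l]%N]].

Definition NC : {set {set {set 'I_n}}} :=
  [set alpha | partition alpha [set: 'I_n] & noncrossing alpha].

(* Blocks are nonempty, so the default values n and 0 play no role. *)
Definition block_min V : nat := \big[minn/n]_(i in V) i.
Definition block_max V : nat := \max_(i in V) i.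

Definition inner alpha V :=
  [exists W in alpha, [&& W != V, (block_min W < block_min V)%N
                        & (block_max V < block_max W)%N]].
Definition outer alpha V := ~~ inner alpha V.

End NonCrossingPartitions.

(* Main.v *)
Require Import Defs.
From mathcomp Require Import all_boot all_order all_algebra.
From mathcomp Require Import boolp reals complex.
From mathcomp Require Import zify.

(** Write M for the moment series, T for the reciprocal S-transform, X for the
    variable and v = (1 + X) T, so that v_k = t_k + t_(k-1) is the weight of an
    inner block of size k, and v_0 = 1.

    On the side of power series, the definition of S says that the compositional
    inverse chi of M satisfies (1 + X) chi = X S.  Multiplying by T gives
    chi v = X, and composing with M gives
<<
      M = X (v o M) = X (1 + M) (T o M),
>>
    which is moment_rec_inner and moment_rec_outer, coefficient by coefficient.

    On the side of partitions, everything follows from one decomposition of the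
    non-crossing partitions of [a, b), sum_NCI_glue.  Let B be the block of the
    least point a and m its last point.  No other block has points on both sides
    of m.  So alpha splits into a partition gamma of [m+1, b) and what it
    induces on [a, m); and the latter is an arbitrary non-crossing partition beta,
    since adding the new last point m to the block of the first point cannot
    create a crossing.  All blocks of beta other than that of a become inner,
    the enlarged block is outer, and the blocks of gamma keep their status.

    Let P_f be the sum over the non-crossing partitions of [a, b), in which the
    block of a is weighted by f_k and every other block by v_k, where k is its
    size, and let H be the same sum with weight v_k for all blocks.  The
    decomposition yields
<<
      P_f [a, b) = sum_m  P_(f') [a, m) * H [m+1, b),     f'_k = f_(k+1).
>>
    If H [m+1, b) is the coefficient of degree b-m-1 of v o M, that is, the
    coefficient of degree b-m of M, this is the recursion for the coefficients
    of f o M that results from f = f_0 + X f'.  Hence P_f is f o M by induction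
    on the length (first_block_sumE), and H is the case f = v.  Taking the outer
    weights t_(k-1), for which f' is T, the same decomposition gives for
    the sum G of the theorem
<<
      G [a, b) = sum_m  (T o M)_(m-a) * G [m+1, b),
>>
    the recursion satisfied by 1 + M (outer_sumE).  *)

Set Implicit Arguments.
Unset Strict Implicit.
Unset Printing Implicit Defensive.

Import GRing.Theory.
Local Open Scope ring_scope.

(** * Algebra of formal power series *)

Section PowerSeries.
Variable K : fieldType.
Implicit Types (f g h : fps K) (p q : {poly K}).

(** Identities between power series are transferred from the commutative ring of
    polynomials: a series is approximated by a polynomial in degrees below n,
    and all operations respect this. *)
Definition approx n f p := forall i, (i < n)%N -> f i = p`_i.

Lemma approx_poly n f : approx n f (\poly_(i < n) f i).
Proof. by move=> i ltin; rewrite coef_poly ltin. Qed.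

Lemma approx_eq f g :
  (forall n, exists2 p, approx n f p & approx n g p) -> f = g.
Proof. by move=> fg; apply/funext => n; have [p -> // ->] := fg n.+1. Qed.

Lemma approx_one n : approx n (@fps_one K) 1.
Proof. by move=> i _; rewrite coef1. Qed.

Lemma approx_add n f g p q :
  approx n f p -> approx n g q -> approx n (fps_add f g) (p + q).
Proof. by move=> fp gq i ltin; rewrite coefD -fp // -gq. Qed.

Lemma approx_mul n f g p q :
  approx n f p -> approx n g q -> approx n (fps_mul f g) (p * q).
Proof.
move=> fp gq i ltin; rewrite coefM; apply: eq_bigr => -[j ltji] _ /=.
by rewrite fp ?gq //; lia.
Qed.

Lemma approx_exp n f p k : approx n f p -> approx n (fps_exp f k) (p ^+ k).
Proof.
move=> fp; elim: k => [|k IHk]; first exact: approx_one.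
by rewrite exprS; apply: approx_mul.
Qed.

(** As g has no constant term, g^k contributes nothing in degrees below k, so
    the different cut-offs of the two sums over k do not matter. *)
Lemma approx_comp n f g p q : g 0%N = 0 ->
  approx n f p -> approx n g q -> approx n (fps_comp f g) (p \Po q).
Proof.
move=> g0 fp gq i ltin; rewrite coef_comp_poly /fps_comp.
pose c k := p`_k * (q ^+ k)`_i.
have c0 k : (i < k)%N || (size p <= k)%N -> c k = 0.
  case/orP=> [ltik|lepk]; last by rewrite /c nth_default ?mul0r.
  by rewrite /c -(approx_exp k gq ltin) fps_exp_lt ?mulr0.
transitivity (\sum_(k < i.+1) c k).
  apply: eq_bigr => -[k ltki] _ /=.
  by rewrite (approx_exp k gq ltin) fp //; lia.
have ext a b : (a <= b)%N -> (forall k, (a <= k)%N -> c k = 0) ->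
    \sum_(k < a) c k = \sum_(k < b) c k.
  move=> leab ca; rewrite (big_ord_widen _ c leab) big_mkcond.
  by apply: eq_bigr => k _; case: ltnP => // /ca.
rewrite (ext _ (maxn i.+1 (size p)) (leq_maxl _ _)); last first.
  by move=> k lek; rewrite c0 ?lek.
by rewrite -(ext _ _ (leq_maxr _ _)) // => k lek; rewrite c0 ?lek ?orbT.
Qed.

Lemma fps_mulC f g : fps_mul f g = fps_mul g f.
Proof.
apply: approx_eq => n; exists ((\poly_(i < n) f i) * \poly_(i < n) g i).
  by apply: approx_mul; apply: approx_poly.
by rewrite mulrC; apply: approx_mul; apply: approx_poly.
Qed.

Lemma fps_mulA f g h : fps_mul f (fps_mul g h) = fps_mul (fps_mul f g) h.
Proof.
apply: approx_eq => n.
exists ((\poly_(i < n) f i) * ((\poly_(i < n) g i) * \poly_(i < n) h i)).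
  by do !(apply: approx_poly || apply: approx_mul).
by rewrite mulrA; do !(apply: approx_poly || apply: approx_mul).
Qed.

Lemma fps_mulr1 f : fps_mul f (@fps_one K) = f.
Proof.
apply: approx_eq => n; exists (\poly_(i < n) f i); last exact: approx_poly.
rewrite -[p in approx _ _ p]mulr1.
by apply: approx_mul; [apply: approx_poly | apply: approx_one].
Qed.

Lemma fps_compM f g h : h 0%N = 0 ->
  fps_comp (fps_mul f g) h = fps_mul (fps_comp f h) (fps_comp g h).
Proof.
move=> h0; apply: approx_eq => n.
exists ((\poly_(i < n) f i * \poly_(i < n) g i) \Po \poly_(i < n) h i).
  by apply: approx_comp => //; [apply: approx_mul|]; apply: approx_poly.
rewrite comp_polyM; apply: approx_mul; apply: approx_comp => //;
  exact: approx_poly.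
Qed.

Lemma fps_compD f g h : h 0%N = 0 ->
  fps_comp (fps_add f g) h = fps_add (fps_comp f h) (fps_comp g h).
Proof.
move=> h0; apply: approx_eq => n.
exists ((\poly_(i < n) f i + \poly_(i < n) g i) \Po \poly_(i < n) h i).
  by apply: approx_comp => //; [apply: approx_add|]; apply: approx_poly.
rewrite comp_polyD; apply: approx_add; apply: approx_comp => //;
  exact: approx_poly.
Qed.

Lemma fps_comp1 h : h 0%N = 0 -> fps_comp (@fps_one K) h = @fps_one K.
Proof.
move=> h0; apply: approx_eq => n; exists (1 \Po \poly_(i < n) h i).
  by apply: approx_comp => //; [apply: approx_one | apply: approx_poly].
by rewrite comp_polyC; apply: approx_one.
Qed.

Lemma fps_mulX0 f : fps_mul (@fps_X K) f 0%N = 0.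
Proof. by rewrite /fps_mul big_ord1 /fps_X mul0r. Qed.

Lemma fps_mulXS f n : fps_mul (@fps_X K) f n.+1 = f n.
Proof.
rewrite /fps_mul big_ord_recl big_ord_recl /= /fps_X /= mul0r mul1r add0r.
by rewrite big1 ?addr0 ?subn1 // => i _; rewrite mul0r.
Qed.

Lemma fps_mul_divX f : f 0%N = 0 -> fps_mul (@fps_X K) (fps_divX f) = f.
Proof.
by move=> f0; apply/funext => -[|n]; rewrite ?fps_mulX0 ?fps_mulXS.
Qed.

Lemma fps_mul_add1X f n :
  fps_mul (fps_add (@fps_one K) (@fps_X K)) f n.+1 = f n.+1 + f n.
Proof.
rewrite /fps_mul big_ord_recl big_ord_recl /= /fps_add /fps_one /fps_X /=.
rewrite addr0 add0r !mul1r subn1 subn0 big1 ?addr0 // => i _.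
by rewrite mul0r.
Qed.

(** The coefficient of degree n+1 in f o g = f_0 + g (f' o g), where
    f = f_0 + X f'. *)
Lemma fps_comp_rec f g n : g 0%N = 0 ->
  fps_comp f g n.+1
    = \sum_(i < n.+1) fps_comp (fps_divX f) g i * g (n - i).+1.
Proof.
move=> g0; pose c : fps K := fun k => if k == 0%N then f 0%N else 0.
have -> : fps_comp f g n.+1 = fps_mul g (fps_comp (fps_divX f) g) n.+1.
  have -> : f = fps_add c (fps_mul (@fps_X K) (fps_divX f)).
    apply/funext => -[|k]; rewrite /fps_add ?fps_mulX0 ?fps_mulXS /c /=.
      by rewrite addr0.
    by rewrite add0r.
  rewrite fps_compD // fps_compM // (funext (fps_compXl g0)) /fps_add.
  rewrite {1}/fps_comp big_ord_recl big1 ?add0r => [|i _]; last first.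
    by rewrite mul0r.
  rewrite mulr0 !add0r; congr (fps_mul g (fps_comp _ g) n.+1).
  by apply/funext => k; rewrite /fps_divX !fps_mulXS /c /= add0r.
rewrite fps_mulC /fps_mul big_ord_recr /= subnn g0 mulr0 addr0.
by apply: eq_bigr => -[i lti] _ /=; rewrite subSn.
Qed.

End PowerSeries.

(** * The functional equation of the moment series *)

Section Moments.
Variables (K : fieldType) (A : algType K) (phi : {scalar A}) (a : A).
Hypothesis phia : phi a = 1.
Let M := moment_series phi a.
Let t := recip_S_transform phi a.

Lemma recip_S_transform0 : t 0%N = 1.
Proof.
by rewrite /t /recip_S_transform /fps_inv fps_recE S_transform0 // divr1
           /fps_mul big_ord1 nth_mkseq0 mulr0 subr0.
Qed.

(** With chi the compositional inverse of M, compose chi v = X with M. *)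
Lemma moment_series_eq :
  M = fps_mul (@fps_X K)
       (fps_comp (fps_mul (fps_add (@fps_one K) (@fps_X K)) t) M).
Proof.
have M0 : M 0%N = 0 by [].
have M1 : M 1%N != 0 by rewrite /M /moment_series expr1 phia oner_neq0.
pose chi := fps_compinv M; pose u := fps_add (@fps_one K) (@fps_X K).
have chiM : fps_comp chi M = @fps_X K by apply/funext/fps_compinvl.
have XS : fps_mul (@fps_X K) (S_transform phi a) = fps_mul u chi.
  by rewrite /S_transform fps_mul_divX // /fps_mul big_ord1 fps_compinv0
    ?mulr0.
have St : fps_mul (S_transform phi a) t = @fps_one K.
  by apply/funext/fps_mulV; rewrite S_transform0 ?oner_neq0.
have chiv : fps_mul chi (fps_mul u t) = @fps_X K.
  by rewrite fps_mulA [fps_mul chi u]fps_mulC -XS -fps_mulA St fps_mulr1.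
by rewrite -/u -{1}chiM -fps_compM // chiv (funext (fps_compXl M0)).
Qed.

Lemma moment_rec_inner n :
  M n.+1 = fps_comp (fps_mul (fps_add (@fps_one K) (@fps_X K)) t) M n.
Proof. by rewrite {1}moment_series_eq fps_mulXS. Qed.

Lemma moment_rec_outer n :
  M n.+1 = \sum_(i < n.+1) fps_comp t M i * fps_add (@fps_one K) M (n - i)%N.
Proof.
rewrite moment_rec_inner fps_compM // fps_mulC; congr (fps_mul _ _ _).
by rewrite fps_compD // fps_comp1 // (funext (fps_compXl _)).
Qed.

End Moments.

(** * Partitions of finite sets *)

Section Partitions.
Variable T : finType.
Implicit Types (P Q : {set {set T}}) (D E V : {set T}).

Definition restr P D := [set V :&: D | V in P] :\ set0.

Lemma restrP P D V :
  reflect (exists2 W, W \in P & V = W :&: D /\ V != set0) (V \in restr P D).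
Proof.
rewrite !inE; apply: (iffP andP) => [[V0 /imsetP[W PW eV]]|[W PW [-> W0]]].
  by exists W; rewrite // -eV.
by split; [exact: W0 | apply: imset_f].
Qed.

Lemma partition_eq_block P D V W x :
  partition P D -> V \in P -> W \in P -> x \in V -> x \in W -> V = W.
Proof.
move=> /partition_trivIset tiP PV PW Vx Wx.
by rewrite -(def_pblock tiP PV Vx) (def_pblock tiP PW Wx).
Qed.

Lemma partition_intro P D :
    (forall x, (x \in D) = (x \in cover P)) -> set0 \notin P ->
    (forall V W x, V \in P -> W \in P -> x \in V -> x \in W -> V = W) ->
  partition P D.
Proof.
move=> covP P0 PI; apply/and3P; split=> //.
  by apply/eqP/setP => x; rewrite covP.
apply/trivIsetP => V W PV PW; apply: contraR => /pred0Pn[x /andP[/= Vx Wx]].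
by apply/eqP; apply: PI Vx Wx.
Qed.

Lemma partition_block P D x :
  partition P D -> x \in D -> exists2 V, V \in P & x \in V.
Proof. by move=> /cover_partition <- /bigcupP. Qed.

Lemma pblock_set0 (x : T) : pblock set0 x = set0.
Proof. by rewrite /pblock; case: pickP => //= A; rewrite inE. Qed.

(** Only one inclusion has to be checked, which halves the verification that
    restricting and gluing are inverse to each other. *)
Lemma eq_partition_sub P Q D :
  partition P D -> partition Q D -> {subset P <= Q} -> P = Q.
Proof.
move=> pP pQ sPQ; apply/eqP; rewrite eqEsubset; apply/andP; split.
  exact/subsetP.
apply/subsetP => V QV; have /set0Pn[x Vx] := partition_neq0 pQ QV.
have Dx : x \in D by apply: subsetP Vx; apply: partitionS QV.
have [W PW Wx] := partition_block pP Dx.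
by rewrite (partition_eq_block pQ QV (sPQ _ PW) Vx Wx).
Qed.

Lemma partition_restr P D E :
  partition P E -> D \subset E -> partition (restr P D) D.
Proof.
move=> pP sDE; apply: partition_intro.
- move=> x; apply/idP/bigcupP => [Dx|[V /restrP[W _ [-> _]]]]; last first.
    by rewrite inE => /andP[].
  have [V PV Vx] := partition_block pP (subsetP sDE _ Dx).
  have VDx : x \in V :&: D by rewrite inE Vx.
  exists (V :&: D) => //; apply/restrP; exists V => //; split=> //.
  by apply/set0Pn; exists x.
- by rewrite !inE eqxx.
move=> _ _ x /restrP[V PV [-> _]] /restrP[W PW [-> _]].
rewrite !inE => /andP[Vx _] /andP[Wx _].
by rewrite (partition_eq_block pP PV PW Vx Wx).
Qed.

End Partitions.

(** * Non-crossing partitions of an interval *)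

Section Intervals.
Variable N : nat.
Implicit Types (alpha beta gamma : {set {set 'I_N}}) (U V W : {set 'I_N}).

Lemma noncrossingP alpha :
  reflect (forall V W (i j k l : 'I_N), V \in alpha -> W \in alpha ->
             i \in V -> j \in W -> k \in V -> l \in W ->
             (i < j)%N -> (j < k)%N -> (k < l)%N -> V = W)
          (noncrossing alpha).
Proof.
apply: (iffP forall_inP) => [nc V W i j k l aV aW Vi Wj Vk Wl ij jk kl|nc V aV].
  have /forall_inP/(_ W aW)/implyP := nc V aV.
  case: eqP => // _ /(_ isT); case/exists_inP; exists i => //.
  apply/exists_inP; exists j => //; apply/exists_inP; exists k => //.
  by apply/exists_inP; exists l => //; rewrite ij jk.
apply/forall_inP => W aW; apply/implyP; apply: contra.
case/exists_inP=> i Vi /exists_inP[j Wj] /exists_inP[k Vk] /exists_inP[l Wl].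
by case/and3P=> ij jk kl; apply/eqP; apply: (nc V W i j k l).
Qed.

Definition intv (a b : nat) : {set 'I_N} := [set i : 'I_N | (a <= i < b)%N].

(** All intervals live in the same ordinal type, so that cutting one at a point
    requires no relabelling of partitions. *)
Definition NCI a b : {set {set {set 'I_N}}} :=
  [set alpha | partition alpha (intv a b) & noncrossing alpha].

Lemma NCI_partition a b alpha :
  alpha \in NCI a b -> partition alpha (intv a b).
Proof. by rewrite inE => /andP[]. Qed.

Lemma NCI_noncrossing a b alpha : alpha \in NCI a b -> noncrossing alpha.
Proof. by rewrite inE => /andP[]. Qed.

Lemma NCI_noncross a b alpha V W (i j k l : 'I_N) :
  alpha \in NCI a b -> V \in alpha -> W \in alpha ->
  i \in V -> j \in W -> k \in V -> l \in W ->
  (i < j)%N -> (j < k)%N -> (k < l)%N -> V = W.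
Proof. by move/NCI_noncrossing/noncrossingP; apply. Qed.

Lemma NCI_block a b alpha V (x : 'I_N) :
  alpha \in NCI a b -> V \in alpha -> x \in V -> (a <= x < b)%N.
Proof.
move/NCI_partition => pa aV Vx.
by have := subsetP (partitionS pa aV) x Vx; rewrite inE.
Qed.

Lemma NCI_pblock_mem a b alpha (x : 'I_N) :
  alpha \in NCI a b -> (a <= x < b)%N -> pblock alpha x \in alpha.
Proof.
move/NCI_partition/cover_partition => ca ax.
by rewrite pblock_mem // ca inE.
Qed.

Lemma NCI_pblock_id a b alpha (x : 'I_N) :
  alpha \in NCI a b -> (a <= x < b)%N -> x \in pblock alpha x.
Proof.
by move/NCI_partition/cover_partition => ca ax; rewrite mem_pblock ca inE.
Qed.

Lemma NCI_eq_block a b alpha V W x :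
  alpha \in NCI a b -> V \in alpha -> W \in alpha -> x \in V -> x \in W ->
  V = W.
Proof. by move/NCI_partition/partition_eq_block; apply. Qed.

Lemma NCI_pblock_sub a b alpha (x y : 'I_N) :
  alpha \in NCI a b -> y \in pblock alpha x -> (a <= y < b)%N.
Proof.
move=> Ha By; apply: NCI_block (Ha) _ (By); rewrite pblock_mem // -mem_pblock.
by move: By; rewrite /pblock; case: pickP => [A /andP[]|_] //=; rewrite inE.
Qed.

Lemma NCI_restr a b c d alpha : (a <= c)%N -> (d <= b)%N ->
  alpha \in NCI a b -> restr alpha (intv c d) \in NCI c d.
Proof.
move=> ac db Ha; have sI : intv c d \subset intv a b.
  by apply/subsetP => x; rewrite !inE; lia.
rewrite inE (partition_restr (NCI_partition Ha) sI) /=.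
apply/noncrossingP => _ _ i j k l /restrP[V aV [-> _]] /restrP[W aW [-> _]].
rewrite !inE => /andP[Vi _] /andP[Wj _] /andP[Vk _] /andP[Wl _] ij jk kl.
by rewrite (NCI_noncross Ha aV aW Vi Wj Vk Wl).
Qed.

Lemma NCI_empty a b : (b <= a)%N -> NCI a b = [set set0].
Proof.
move=> ba; have I0 : intv a b = set0 by apply/setP => x; rewrite !inE; lia.
apply/setP => alpha; rewrite !inE I0 partition_set0.
by case: eqP => // ->; apply/noncrossingP => V W i j k l; rewrite inE.
Qed.

Lemma block_extrema (V : {set 'I_N}) : V != set0 ->
  exists i j : 'I_N, [/\ i \in V, j \in V, block_min V = i, block_max V = j &
                     {in V, forall k : 'I_N, i <= k <= j}%N].
Proof.
case/set0Pn => x Vx.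
pose i := [arg min_(i < x in V) i]%N; pose j := [arg max_(j > x in V) j]%N.
have [Vi imin] : i \in V /\ {in V, forall k : 'I_N, i <= k}%N.
  by rewrite /i; case: arg_minnP.
have [Vj jmax] : j \in V /\ {in V, forall k : 'I_N, k <= j}%N.
  by rewrite /j; case: arg_maxnP.
exists i, j; split=> // [||k Vk]; last by rewrite imin ?jmax.
- apply/eqP; rewrite eqn_leq; apply/andP; split.
    exact: (@Order.TotalTheory.bigmin_le_cond _ nat _ N i (mem V)
             (@nat_of_ord N)).
  rewrite /block_min; elim/big_ind: _ => [|p q ip iq|k /imin//].
    exact: ltnW.
  by rewrite leq_min ip.
apply/eqP; rewrite eqn_leq; apply/andP; split; first exact/bigmax_leqP.
exact: (@leq_bigmax_cond _ _ (@nat_of_ord N)).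
Qed.

(** Speaks of points of the covering block instead of its extrema, whose
    definitions involve default values. *)
Lemma innerP alpha D V : partition alpha D -> V \in alpha ->
  reflect (exists W (i l : 'I_N), [/\ W \in alpha, i \in W, l \in W &
             {in V, forall j : 'I_N, i < j < l}%N])
          (inner alpha V).
Proof.
move=> Ha aV; apply: (iffP exists_inP);
  have [i [l [Vi Vl emin emax Vil]]] := block_extrema (partition_neq0 Ha aV).
  case=> W aW /and3P[WV].
  have [p [q [Wp Wq -> -> _]]] := block_extrema (partition_neq0 Ha aW).
  rewrite emin emax => pi lq; exists W, p, q; split=> // j /Vil.
  by lia.
case=> W [p [q [aW Wp Wq Vpq]]].
have [p' [q' [_ _ pmin qmax Wpq]]] := block_extrema (partition_neq0 Ha aW).
exists W => //; rewrite emin emax pmin qmax.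
have := Wpq p Wp; have := Wpq q Wq; have := Vpq i Vi; have := Vpq l Vl.
move=> ????; apply/and3P; split; [|lia|lia].
by apply/eqP => eWV; have := Vpq p; rewrite -eWV => /(_ Wp); rewrite ltnn.
Qed.

(** * Cutting at the last point of the first block *)

Section Glue.
Variables (a m : 'I_N) (b : nat).

(** If a = m then beta is the empty partition and [pblock beta a] is the empty
    set, so the first block becomes the singleton of m, as it should. *)
Definition glue beta gamma :=
  (m |: pblock beta a) |: ((beta :\ pblock beta a) :|: gamma).

Hypotheses (am : (a <= m)%N) (mb : (m < b)%N).

Section GluePair.
Variables beta gamma : {set {set 'I_N}}.
Hypotheses (Hb : beta \in NCI a m) (Hc : gamma \in NCI m.+1 b).
Let B := pblock beta a.

Lemma glueP V : reflect
  [\/ V = m |: B, V \in beta /\ V <> B | V \in gamma] (V \in glue beta gamma).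
Proof.
rewrite !inE; apply: (iffP or3P); case.
- by move/eqP; constructor 1.
- by case/andP=> /eqP; constructor 2.
- by constructor 3.
- by move->; constructor 1.
- by case=> bV /eqP VB; constructor 2; rewrite VB.
- by constructor 3.
Qed.

Lemma pblock_first V x : V \in beta -> x \in V -> a \in B /\ B \in beta.
Proof.
move=> bV Vx; have /andP[ax xm] := NCI_block Hb bV Vx.
have amx : (a <= a < m)%N by rewrite leqnn (leq_ltn_trans ax xm).
by rewrite /B (NCI_pblock_id Hb amx) (NCI_pblock_mem Hb amx).
Qed.

Lemma pblock_first_lt V x :
  V \in beta -> V <> B -> x \in V -> (a < x < m)%N.
Proof.
move=> bV VB Vx; have /andP[ax xm] := NCI_block Hb bV Vx.
rewrite ltn_neqAle ax xm !andbT; apply/eqP => /val_inj eax.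
have [Ba bB] := pblock_first bV Vx.
by apply: VB; apply: (NCI_eq_block Hb bV bB Vx); rewrite -eax.
Qed.

Lemma mem_joined x : x \in m |: B -> x = m \/ x \in B /\ (x < m)%N.
Proof.
rewrite !inE => /orP[/eqP|Bx]; [by left|right].
by have /andP[] := NCI_pblock_sub Hb Bx.
Qed.

Lemma joined_first : a \in m |: B.
Proof.
rewrite !inE; case: ltngtP am => [lt_am|//|/val_inj->] _; last by rewrite eqxx.
by rewrite (NCI_pblock_id Hb) ?orbT // leqnn.
Qed.

Lemma card_joined : #|m |: B| = #|B|.+1.
Proof.
rewrite cardsU1; case: (boolP (m \in _)) => //= Bm.
by have := NCI_pblock_sub Hb Bm; rewrite ltnn andbF.
Qed.

Lemma glue_partition : partition (glue beta gamma) (intv a b).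
Proof.
apply: partition_intro.
- move=> x; rewrite inE.
  apply/idP/bigcupP => [axb|[V /glueP[->|[bV VB]|cV] Vx]].
  + case: (ltngtP x m) => [xm|mx|/val_inj->]; last first.
    * by exists (m |: B); [apply/glueP; constructor 1 | rewrite !inE eqxx].
    * have xI : x \in intv m.+1 b by rewrite inE; lia.
      have [V cV Vx] := partition_block (NCI_partition Hc) xI.
      by exists V => //; apply/glueP; constructor 3.
    have xI : x \in intv a m by rewrite inE; lia.
    have [V bV Vx] := partition_block (NCI_partition Hb) xI.
    case: (eqVneq V B) => [VB|/eqP VB].
      exists (m |: B); first by apply/glueP; constructor 1.
      by rewrite !inE -VB Vx orbT.
    by exists V => //; apply/glueP; constructor 2.
  + case: (mem_joined Vx) => [->|[Bx xm]]; first lia.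
    by have := NCI_pblock_sub Hb Bx; lia.
  + by have := pblock_first_lt bV VB Vx; lia.
  + by have := NCI_block Hc cV Vx; lia.
- apply/glueP => -[/setP/(_ m)|[b0 _]|c0]; first by rewrite !inE eqxx.
    by rewrite (partition0 (NCI_partition Hb)) in b0.
  by rewrite (partition0 (NCI_partition Hc)) in c0.
move=> V W x /glueP[->|[bV VB]|cV] /glueP[->|[bW WB]|cW] // Vx Wx.
- have xm := pblock_first_lt bW WB Wx.
  case: (mem_joined Vx) => [ex|[Bx _]]; first by move: xm; rewrite ex; lia.
  have [_ bB] := pblock_first bW Wx.
  by case: WB; apply: NCI_eq_block Hb bW bB Wx Bx.
- have := NCI_block Hc cW Wx; case: (mem_joined Vx) => [->|[_]]; lia.
- have xm := pblock_first_lt bV VB Vx.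
  case: (mem_joined Wx) => [ex|[Bx _]]; first by move: xm; rewrite ex; lia.
  have [_ bB] := pblock_first bV Vx.
  by case: VB; apply: NCI_eq_block Hb bV bB Vx Bx.
- exact: NCI_eq_block Hb bV bW Vx Wx.
- by have := NCI_block Hc cW Wx; have := NCI_block Hb bV Vx; lia.
- have := NCI_block Hc cV Vx; case: (mem_joined Wx) => [->|[_]]; lia.
- by have := NCI_block Hc cV Vx; have := NCI_block Hb bW Wx; lia.
- exact: NCI_eq_block Hc cV cW Vx Wx.
Qed.

Lemma glue_le V x : V \in glue beta gamma -> x \in V -> V \notin gamma ->
  (x <= m)%N.
Proof.
case/glueP=> [->|[bV _]|->] // Vx _.
  by case: (mem_joined Vx) => [->|[_ /ltnW]].
by have /andP[_ /ltnW] := NCI_block Hb bV Vx.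
Qed.

(** A crossing that is not already one of beta or gamma uses m as the last of its
    four points; dropping m and putting a in front turns it into a crossing of
    beta. *)
Lemma glue_noncrossing : noncrossing (glue beta gamma).
Proof.
apply/noncrossingP => V W i j k l gV gW Vi Wj Vk Wl ij jk kl.
have [cV|NcV] := boolP (V \in gamma); have [cW|NcW] := boolP (W \in gamma).
- exact: NCI_noncross Hc cV cW Vi Wj Vk Wl ij jk kl.
- by move: (NCI_block Hc cV Vi) (glue_le gW Wj NcW) ij; clear; lia.
- by move: (NCI_block Hc cW Wj) (glue_le gV Vk NcV) jk; clear; lia.
have lm := glue_le gW Wl NcW.
have neq_m (x : 'I_N) : (x < m)%N -> x \in m |: B -> x \in B.
  by rewrite !inE => xm /orP[/eqP ex|//]; rewrite ex ltnn in xm.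
case/glueP: gV => [eV|[bV VB]|/(negP NcV)//];
  case/glueP: gW => [eW|[bW WB]|/(negP NcW)//].
- by rewrite eV eW.
- have [_ bB] := pblock_first bW Wj.
  have km := leq_trans kl lm; rewrite eV in Vi Vk.
  have Bi := neq_m i (ltn_trans (ltn_trans ij jk) km) Vi.
  by case: WB; apply/esym/(NCI_noncross Hb bB bW Bi Wj (neq_m k km Vk) Wl).
(* Here l may be m; the quadruple a < i < j < k avoids it. *)
- have [Ba bB] := pblock_first bV Vi.
  have /andP[ai _] := pblock_first_lt bV VB Vi.
  have Bj : j \in B.
    by apply: neq_m; rewrite -?eW // (leq_trans (ltn_trans jk kl)).
  by case: VB; apply/esym/(NCI_noncross Hb bB bV Ba Vi Bj Vk).
- exact: NCI_noncross Hb bV bW Vi Wj Vk Wl ij jk kl.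
Qed.

Lemma glue_NCI : glue beta gamma \in NCI a b.
Proof. by rewrite inE glue_partition glue_noncrossing. Qed.

(** It contains the least point a, which no block can precede. *)
Lemma outer_joined : inner (glue beta gamma) (m |: B) = false.
Proof.
have aV : m |: B \in glue beta gamma by apply/glueP; constructor 1.
apply/(innerP glue_partition aV) => -[W [i [l [aW Wi _ Bil]]]].
have /andP[ia _] := Bil a joined_first.
by have /andP[ai _] := NCI_block glue_NCI aW Wi; rewrite ltnNge ai in ia.
Qed.

(** The enlarged block covers the other blocks of beta, from a to m. *)
Lemma inner_under_joined V :
  V \in beta -> V != B -> inner (glue beta gamma) V.
Proof.
move=> bV /eqP VB.
have aV : V \in glue beta gamma by apply/glueP; constructor 2.
apply/(innerP glue_partition aV); exists (m |: B), a, m.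
split; [by apply/glueP; constructor 1|exact: joined_first|exact: setU11|].
by move=> j Vj; apply: (pblock_first_lt bV VB Vj).
Qed.

(** A block covering one of gamma has points beyond m, hence lies in gamma. *)
Lemma inner_after_joined V :
  V \in gamma -> inner (glue beta gamma) V = inner gamma V.
Proof.
move=> cV; have aV : V \in glue beta gamma by apply/glueP; constructor 3.
apply/(innerP glue_partition aV)/(innerP (NCI_partition Hc) cV);
  case=> W [i [l [aW Wi Wl Vil]]]; last first.
  by exists W, i, l; split=> //; apply/glueP; constructor 3.
exists W, i, l; split=> //; apply: contraT => NcW.
have /set0Pn[j Vj] := partition_neq0 (NCI_partition Hc) cV.
by move: (glue_le aW Wl NcW) (Vil j Vj) (NCI_block Hc cV Vj); clear; lia.
Qed.

Lemma pblock_glue : pblock (glue beta gamma) a = m |: B.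
Proof.
apply: def_pblock (partition_trivIset glue_partition) _ joined_first.
by apply/glueP; constructor 1.
Qed.

Lemma restr_glue_l : restr (glue beta gamma) (intv a m) = beta.
Proof.
apply/esym/(eq_partition_sub (NCI_partition Hb)).
  by apply: NCI_partition; apply: NCI_restr glue_NCI => //; lia.
move=> V bV; have V0 := partition_neq0 (NCI_partition Hb) bV.
have /setIidPl VI := partitionS (NCI_partition Hb) bV.
apply/restrP; case: (eqVneq V B) => [VB|/eqP VB]; last first.
  by exists V => //; apply/glueP; constructor 2.
exists (m |: B); first by apply/glueP; constructor 1.
split=> //; rewrite setIUl -VB VI; apply/setP => x; rewrite !inE.
by case: eqP => // ->; rewrite ltnn !andbF.
Qed.

Lemma restr_glue_r : restr (glue beta gamma) (intv m.+1 b) = gamma.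
Proof.
apply/esym/(eq_partition_sub (NCI_partition Hc)).
  by apply: NCI_partition; apply: NCI_restr glue_NCI => //; lia.
move=> V cV; have V0 := partition_neq0 (NCI_partition Hc) cV.
have /setIidPl VI := partitionS (NCI_partition Hc) cV.
by apply/restrP; exists V => //; apply/glueP; constructor 3.
Qed.

Lemma big_glue (R : comNzRingType) (F : {set 'I_N} -> R) :
  \prod_(V in glue beta gamma) F V =
  F (m |: B) * ((\prod_(V in beta | V != B) F V) * \prod_(V in gamma) F V).
Proof.
rewrite big_setU1 /=; last first.
  apply/negP; rewrite !inE => /orP[/andP[_ bV]|cV].
    have mV : m \in m |: B by rewrite !inE eqxx.
    by have := NCI_block Hb bV mV; lia.
  by have := NCI_block Hc cV (setU11 _ _); lia.
congr (_ * _).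
transitivity (\prod_(V in [predU beta :\ B & gamma]) F V).
  by apply: eq_bigl => V; rewrite !inE.
rewrite bigU /=; last first.
  apply/pred0P => V; apply/negP => /andP[/= /setD1P[_ bV] cV].
  have /set0Pn[x Vx] := partition_neq0 (NCI_partition Hb) bV.
  by have := NCI_block Hb bV Vx; have := NCI_block Hc cV Vx; lia.
by congr (_ * _); apply: eq_bigl => V; rewrite !inE andbC.
Qed.

End GluePair.

(** A block other than that of a lies on one side of m: points x < m < y of it
    would give the crossing a < x < m < y with the block of a. *)
Lemma glue_restr alpha : alpha \in NCI a b ->
  m \in pblock alpha a -> {in pblock alpha a, forall x : 'I_N, x <= m}%N ->
  glue (restr alpha (intv a m)) (restr alpha (intv m.+1 b)) = alpha.
Proof.
move=> Ha; set B := pblock alpha a => Bm Bmax.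
have axb : (a <= a < b)%N by lia.
have Ba : a \in B by apply: NCI_pblock_id Ha axb.
have aB : B \in alpha by apply: NCI_pblock_mem Ha axb.
have Hb : restr alpha (intv a m) \in NCI a m by apply: NCI_restr Ha; lia.
have Hc : restr alpha (intv m.+1 b) \in NCI m.+1 b by apply: NCI_restr Ha; lia.
set beta := restr alpha (intv a m) in Hb *.
have eB : pblock beta a = B :&: intv a m.
  have [lt_am|le_ma] := ltnP a m; last first.
    have -> : intv a m = set0 by apply/setP => x; rewrite !inE; lia.
    have := Hb; rewrite NCI_empty // setI0 inE => /eqP->.
    by rewrite pblock_set0.
  have BIa : a \in B :&: intv a m by rewrite !inE Ba leqnn.
  apply: def_pblock (partition_trivIset (NCI_partition Hb)) _ (BIa).
  by apply/restrP; exists B => //; split=> //; apply/set0Pn; exists a.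
apply/esym/(eq_partition_sub (NCI_partition Ha)); first exact: glue_partition.
move=> V aV; apply/(glueP _ _ V).
case: (eqVneq V B) => [->|/eqP VB].
  constructor 1; rewrite eB; apply/setP => x; rewrite !inE.
  have [->|/eqP xm] := eqVneq x m; first by rewrite Bm.
  have [Bx|//] := boolP (x \in B).
  have := Bmax x Bx; have := NCI_block Ha aB Bx.
  have : nat_of_ord x <> m by move/val_inj.
  by lia.
have NB x : x \in V -> x \in B -> False.
  by move=> Vx Bx; apply: VB; apply: NCI_eq_block Ha aV aB Vx Bx.
have V0 := partition_neq0 (NCI_partition Ha) aV.
have [x0 Vx0] := set0Pn _ V0.
have split_V x y : x \in V -> y \in V -> (x <= m)%N -> (m <= y)%N -> False.
  move=> Vx Vy xm my; have := NCI_block Ha aV Vx => axb'.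
  have Nxm : nat_of_ord x <> m.
    by move/val_inj => ex; apply: (NB x) => //; rewrite ex.
  have Nym : nat_of_ord y <> m.
    by move/val_inj => ey; apply: (NB y) => //; rewrite ey.
  have Nxa : nat_of_ord x <> a.
    by move/val_inj => ex; apply: (NB x) => //; rewrite ex.
  apply: VB; apply/esym/(NCI_noncross Ha aB aV Ba Vx Bm Vy).
  - by move: axb' Nxa; clear; lia.
  - by move: xm Nxm; clear; lia.
  - by move: my Nym; clear; lia.
have [x0m|mx0] := leqP x0 m.
  have VI : V :&: intv a m = V.
    apply/setIidPl/subsetP => x Vx; rewrite inE.
    have /andP[-> xb] := NCI_block Ha aV Vx.
    by case: (ltnP x m) => // mx; case: (split_V x0 x).
  constructor 2; split; first by apply/restrP; exists V; rewrite ?VI.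
  rewrite eB => eV; apply: (NB x0) => //.
  by move: Vx0; rewrite eV inE => /andP[].
constructor 3; apply/restrP; exists V => //; split=> //.
apply/esym/setIidPl/subsetP => x Vx; rewrite inE.
have /andP[_ ->] := NCI_block Ha aV Vx; rewrite andbT.
by case: (ltnP m x) => // xm; case: (split_V x x0); rewrite ?(ltnW mx0).
Qed.

End Glue.

(** Sort the partitions by the last point m of the block of a; for each m,
    gluing is a bijection whose inverse is the restriction to both sides of m. *)
Lemma sum_NCI_glue (R : nmodType) (F : {set {set 'I_N}} -> R) (a : 'I_N) b :
  (a < b)%N ->
  \sum_(alpha in NCI a b) F alpha =
  \sum_(m < N | (a <= m < b)%N)
     \sum_(beta in NCI a m) \sum_(gamma in NCI m.+1 b) F (glue a m beta gamma).
Proof.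
move=> ab; have axb : (a <= a < b)%N by lia.
pose last_of alpha := [arg max_(i > a in pblock alpha a) i]%N.
have lastP alpha : alpha \in NCI a b ->
    (last_of alpha \in pblock alpha a) /\
    {in pblock alpha a, forall x : 'I_N, x <= last_of alpha}%N.
  move=> Ha; rewrite /last_of; case: arg_maxnP => [|i Bi imax]; last by [].
  exact: NCI_pblock_id Ha axb.
rewrite (partition_big last_of (fun m => (a <= m < b)%N)) /=; last first.
  by move=> alpha Ha; have [Bm _] := lastP _ Ha; apply: NCI_pblock_sub Bm.
apply: eq_bigr => m /andP[am mb]; rewrite pair_big /=.
rewrite (reindex_onto (fun p => glue a m p.1 p.2)
  (fun alpha => (restr alpha (intv a m), restr alpha (intv m.+1 b)))) /=.
  apply: eq_bigl => -[beta gamma] /=.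
  apply/andP/andP => [[/andP[Ha _] /eqP[eb ec]]|[Hb Hc]].
    by split; [rewrite -eb | rewrite -ec]; apply: NCI_restr Ha; lia.
  have Ha := glue_NCI am mb Hb Hc; have [Bm Bmax] := lastP _ Ha.
  rewrite (restr_glue_l am mb Hb Hc) (restr_glue_r am mb Hb Hc) Ha.
  split=> //=; apply/eqP/val_inj/eqP.
  rewrite (pblock_glue am mb Hb Hc) in Bm Bmax.
  rewrite eqn_leq Bmax ?setU11 // andbT.
  by case: (mem_joined Hb Bm) => [->|[_ /ltnW]].
move=> alpha /andP[Ha /eqP <-]; have [Bm Bmax] := lastP _ Ha.
by have := NCI_pblock_sub Ha Bm => ?; apply: glue_restr => //; lia.
Qed.

End Intervals.

(** * Weighted sums over non-crossing partitions *)

Section Weights.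
Variables (K : fieldType) (N : nat) (t : fps K).
Hypothesis t0 : t 0%N = 1.
Let v : fps K := fps_mul (fps_add (@fps_one K) (@fps_X K)) t.
Implicit Types (f : fps K) (a b : nat) (alpha : {set {set 'I_N}}).

(** The weight of the block of a is left free since cutting off its last point
    shifts it.  For the empty interval, the only term is f 0. *)
Definition first_block_sum f (a : 'I_N) b : K :=
  \sum_(alpha in NCI N a b) f #|pblock alpha a| *
     \prod_(V in alpha | V != pblock alpha a) v #|V|.

Definition inner_sum a b : K :=
  \sum_(alpha in NCI N a b) \prod_(V in alpha) v #|V|.

Definition weight alpha (V : {set 'I_N}) : K :=
  if inner alpha V then v #|V| else t (#|V| - 1)%N.

Definition outer_sum a b : K :=
  \sum_(alpha in NCI N a b) \prod_(V in alpha) weight alpha V.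

Lemma inner_weight0 : v 0%N = 1.
Proof. by rewrite /v /fps_mul big_ord1 t0 mulr1 /fps_add addr0. Qed.

Lemma first_block_sum0 f (a : 'I_N) : first_block_sum f a a = f 0%N.
Proof.
rewrite /first_block_sum NCI_empty // big_set1 pblock_set0 cards0.
rewrite big1 ?mulr1 //.
by move=> V; rewrite inE.
Qed.

Lemma inner_sum0 a b : (b <= a)%N -> inner_sum a b = 1.
Proof. by move=> ba; rewrite /inner_sum NCI_empty // big_set1 big_set0. Qed.

Lemma outer_sum0 a b : (b <= a)%N -> outer_sum a b = 1.
Proof. by move=> ba; rewrite /outer_sum NCI_empty // big_set1 big_set0. Qed.

Lemma inner_sum_first_block (a : 'I_N) b : (a < b)%N ->
  inner_sum a b = first_block_sum v a b.
Proof.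
move=> ab; apply: eq_bigr => alpha Ha.
by rewrite (bigD1 (pblock alpha a)) //=; apply: NCI_pblock_mem Ha _; lia.
Qed.

(** The first block of the glued partition has one point more than that of beta,
    which turns f into its shift [fps_divX f]. *)
Lemma first_block_sum_rec f (a : 'I_N) b : (a < b)%N ->
  first_block_sum f a b =
  \sum_(m < N | (a <= m < b)%N)
     first_block_sum (fps_divX f) a m * inner_sum m.+1 b.
Proof.
move=> ab; rewrite /first_block_sum sum_NCI_glue //.
apply: eq_bigr => m /andP[am mb]; rewrite big_distrlr /=.
apply: eq_bigr => beta Hb; apply: eq_bigr => gamma Hc.
rewrite (pblock_glue am mb Hb Hc) (card_joined Hb) -mulrA; congr (_ * _).
have NmB V : V \in beta \/ V \in gamma -> V != m |: pblock beta a.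
  move=> bcV; apply/eqP => eV; have Vm : m \in V by rewrite eV setU11.
  case: bcV => [bV|cV]; first by have := NCI_block Hb bV Vm; lia.
  by have := NCI_block Hc cV Vm; lia.
rewrite big_mkcondr (big_glue am mb Hb Hc) eqxx mul1r.
congr (_ * _); last by apply: eq_bigr => V cV; rewrite NmB //; right.
by apply: eq_bigr => V /andP[bV _]; rewrite NmB //; left.
Qed.

(** The shift in the outer weight t (#|U| - 1) cancels the point m that was
    added to the first block. *)
Lemma outer_sum_rec (a : 'I_N) b : (a < b)%N ->
  outer_sum a b =
  \sum_(m < N | (a <= m < b)%N) first_block_sum t a m * outer_sum m.+1 b.
Proof.
move=> ab; rewrite /outer_sum sum_NCI_glue //.
apply: eq_bigr => m /andP[am mb]; rewrite big_distrlr /=.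
apply: eq_bigr => beta Hb; apply: eq_bigr => gamma Hc.
rewrite (big_glue am mb Hb Hc) {1}/weight (outer_joined am mb Hb Hc).
rewrite (card_joined Hb) subn1 -mulrA; congr (_ * (_ * _)).
  apply: eq_bigr => V /andP[bV VB].
  by rewrite /weight (inner_under_joined am mb Hb Hc).
by apply: eq_bigr => V cV; rewrite /weight (inner_after_joined am mb Hb Hc).
Qed.

Lemma sum_interval (F : nat -> nat -> K) a b n : (b <= N)%N -> b = (a + n)%N ->
  \sum_(m < N | (a <= m < b)%N) F (m - a)%N (b - m.+1)%N
    = \sum_(i < n) F i (n - i.+1)%N.
Proof.
move=> bN eb; transitivity (\sum_(a <= m < b) F (m - a)%N (b - m.+1)%N).
  rewrite big_geq_mkord /= -(big_mkord (fun m => (a <= m)%N)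
    (fun m => F (m - a)%N (b - m.+1)%N)) (big_nat_widen _ _ _ _ _ bN).
  by rewrite big_mkord.
rewrite eb -{1}[a]add0n big_addn addKn big_mkord.
apply: eq_bigr => -[i lti] _ /=.
by congr F; lia.
Qed.

Variable M : fps K.
Hypotheses (M0 : M 0%N = 0) (M_inner : forall n, M n.+1 = fps_comp v M n).
Hypothesis M_outer : forall n,
  M n.+1 = \sum_(i < n.+1) fps_comp t M i * fps_add (@fps_one K) M (n - i)%N.

(** The interval may be empty with a = N, where no point a exists; this is the
    reason for treating the sum over all inner weights separately, and there
    v 0 = 1 is needed. *)
Lemma inner_sumE a b : (a <= b <= N)%N ->
    (forall a' : 'I_N, a' = a :> nat ->
       first_block_sum v a' b = fps_comp v M (b - a)%N) ->
  inner_sum a b = fps_comp v M (b - a)%N.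
Proof.
move=> /andP[ab bN] IH; have [ltab|leba] := ltnP a b; last first.
  have -> : (b - a = 0)%N by lia.
  by rewrite inner_sum0 // fps_comp0 inner_weight0.
have ltaN : (a < N)%N by lia.
by rewrite -(IH (Ordinal ltaN)) // -inner_sum_first_block.
Qed.

(** Compare the recursion with that of [fps_comp_rec], whose factors
    M (n - i).+1 are coefficients of v o M by the equation for M. *)
Lemma first_block_sumE f (a : 'I_N) b : (a <= b <= N)%N ->
  first_block_sum f a b = fps_comp f M (b - a)%N.
Proof.
have [n] := ubnP (b - a); elim: n => // n IHn in f a b * => ltn /andP[ab bN].
have [ltab|leba] := ltnP a b; last first.
  have -> : b = a by lia.
  by rewrite subnn first_block_sum0 fps_comp0.
have [k eb] : exists k, b = (a + k.+1)%N by exists (b - a.+1)%N; lia.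
have -> : (b - a = k.+1)%N by lia.
rewrite first_block_sum_rec // fps_comp_rec //.
rewrite -(sum_interval (fun i j => fps_comp (fps_divX f) M i * M j.+1)
            bN eb).
apply: eq_bigr => m /andP[am mb]; rewrite M_inner; congr (_ * _).
  by apply: IHn; lia.
apply: inner_sumE => [|a' ea]; first lia.
by rewrite -ea; apply: IHn; lia.
Qed.

(** Compare the recursion with the equation M = X (T o M) (1 + M). *)
Lemma outer_sumE a b : (a <= b <= N)%N ->
  outer_sum a b = fps_add (@fps_one K) M (b - a)%N.
Proof.
have [n] := ubnP (b - a); elim: n => // n IHn in a b * => ltn /andP[ab bN].
have [ltab|leba] := ltnP a b; last first.
  have -> : (b - a = 0)%N by lia.
  by rewrite outer_sum0 // /fps_add M0 addr0.
have [k eb] : exists k, b = (a + k.+1)%N by exists (b - a.+1)%N; lia.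
have ltaN : (a < N)%N by lia.
have -> : (b - a = k.+1)%N by lia.
rewrite (@outer_sum_rec (Ordinal ltaN)) // {1}/fps_add add0r.
rewrite M_outer -(sum_interval (fun i j => fps_comp t M i *
            fps_add (@fps_one K) M j) bN eb).
by apply: eq_bigr => m /andP[/= am mb]; rewrite first_block_sumE ?IHn //=; lia.
Qed.

End Weights.

Theorem theorem4p5 (R : realType) (A : algType R[i]) (phi : {scalar A})
    (phi1 : phi 1 = 1) (a : A) (phia : phi a = 1) (n : nat) (n_ge1 : (1 <= n)%N) :
  let t := recip_S_transform phi a in
  phi (a ^+ n) =
    \sum_(alpha in NC n)
      (\prod_(U in alpha | outer alpha U) t (#|U| - 1)%N) *
      (\prod_(V in alpha | inner alpha V) (t (#|V| - 1)%N + t #|V|)).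
Proof.
move=> t; pose M := moment_series phi a.
have := @outer_sumE _ n t (recip_S_transform0 phia) M erefl
  (moment_rec_inner phia) (moment_rec_outer phia) 0%N n (leqnn n).
rewrite subn0 /fps_add /fps_one /M /moment_series.
case: n n_ge1 => // n _; rewrite /= add0r => <-; rewrite /outer_sum.
have -> : NCI n.+1 0 n.+1 = NC n.+1.
  apply/setP => alpha; rewrite !inE; congr (partition alpha _ && _).
  by apply/setP => i; rewrite !inE ltn_ord.
apply: eq_bigr => alpha; rewrite inE => /andP[pa _].
rewrite (bigID (inner alpha)) /= mulrC; congr (_ * _).
  by apply: eq_bigr => V /andP[_ /negPf NV]; rewrite /weight NV.
apply: eq_bigr => V /andP[aV iV]; rewrite /weight iV.
have : (0 < #|V|)%N by rewrite card_gt0 (partition_neq0 pa aV).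
by case: #|V| => // k _; rewrite fps_mul_add1X subn1 addrC.
Qed.
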